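(* Let $c>0$. The Gromov width of $D^*\mathcal{E}(1,1,c,c)$ satisfies $$c_{Gr}(D^*\mathcal{E}(1,1,c,c))\ \geq\ \begin{cases}2\pi c, & \text{if } c<1,\\ 2\pi, & \text{if } c\geq1.\end{cases}$$
   Context: $\mathcal{E}(1,1,c,c)=\{x\in\mathbb{R}^4\mid x_1^2+x_2^2+x_3^2/c^2+x_4^2/c^2=1\}$. $D^*\mathcal{E}(1,1,c,c)\subset T^*\mathcal{E}(1,1,c,c)$ is the set of covectors of norm less than $1$ (norm induced by the Euclidean metric of $\mathbb{R}^4$), with the canonical symplectic form. For a symplectic manifold $(M^{2n},\omega)$, the Gromov width $c_{Gr}(M,\omega)$ is the supremum of $a>0$ such that there exists a symplectic embedding $(B^{2n}(a),\omega_0)\to(M,\omega)$, where $$B^{2n}(a)=\Big\{(x_1,y_1,\dots,x_n,y_n)\in\mathbb{R}^{2n}\ \Big|\ \sum_{i=1}^n(x_i^2+y_i^2)\le a/\pi\Big\},\qquad \omega_0=\sum_{i=1}^n dx_i\wedge dy_i .$$ *)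

(* Defs.v *)
From HB Require Import structures.
From mathcomp Require Import all_boot all_order all_algebra.
From mathcomp Require Import all_classical all_reals all_analysis.
From mathcomp Require Import ring.

Set Implicit Arguments.
Unset Strict Implicit.
Unset Printing Implicit Defensive.

Import Order.TTheory GRing.Theory Num.Theory.
Import numFieldNormedType.Exports.

Local Open Scope classical_set_scope.
Local Open Scope ring_scope.

(* A point of R^(2n) is a pair (x, y) of vectors of R^n, that is, the
   coordinates x_1, y_1, ..., x_n, y_n are grouped as (x_1..x_n), (y_1..y_n).
   The library norm on these spaces is the sup norm; it is used only through
   the topology and the differential calculus it induces. *)
Notation phase_space R n := ('rV[R]_n * 'rV[R]_n)%type.

Definition dot (R : realType) (n : nat) (u v : 'rV[R]_n) : R :=
  \sum_(i < n) u 0 i * v 0 i.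

Definition euclidean_norm (R : realType) (n : nat) (u : 'rV[R]_n) : R :=
  Num.sqrt (dot u u).

(* C^k on an open set U; meaningful for finite-dimensional V, where the total
   derivatives of order k are determined by the iterated directional ones. *)
Fixpoint Ck_on (R : realType) (V W : normedModType R) (k : nat) (U : set V)
    (f : V -> W) : Prop :=
  if k is k'.+1 then
    (forall x, U x -> differentiable f x) /\
    (forall v, Ck_on k' U (fun x => 'D_v f x))
  else forall x, U x -> {for x, continuous f}.

Definition smooth_on (R : realType) (V W : normedModType R) (U : set V)
    (f : V -> W) : Prop :=
  forall k, Ck_on k U f.

Definition omega0 (R : realType) (n : nat) (u v : phase_space R n) : R :=
  \sum_(i < n) (u.1 0 i * v.2 0 i - u.2 0 i * v.1 0 i).

Definition symplectic_ball (R : realType) (n : nat) (a : R) :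
    set (phase_space R n) :=
  [set z : phase_space R n | \sum_(i < n) (z.1 0 i ^+ 2 + z.2 0 i ^+ 2) <= a / pi].

(* Smooth embedding of a closed region B into a submanifold M of the vector
   space W. Smoothness up to the boundary of B means smoothness on an open
   neighbourhood of B; as B is used below as the closure of its interior, the
   differential on B does not depend on the extension. *)
Definition smooth_embedding (R : realType) (V W : normedModType R)
    (B : set V) (M : set W) (f : V -> W) : Prop :=
  [/\ exists U : set V, [/\ open U, B `<=` U & smooth_on U f],
      forall z, B z -> M (f z),
      forall z, B z -> injective ('d f z) &
      exists g : W -> V,
        {within f @` B, continuous g} /\ (forall z, B z -> g (f z) = z)].

(* Meant for M a 2n-dimensional submanifold of W such that the restriction to
   TM of the 2-form omega on W is the symplectic form of M. *)
Definition symplectic_embedding (R : realType) (n : nat)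
    (W : normedModType R) (B : set (phase_space R n)) (M : set W)
    (omega : W -> W -> W -> R) (f : phase_space R n -> W) : Prop :=
  smooth_embedding B M f /\
  (forall z, B z -> forall u v,
     omega (f z) ('d f z u) ('d f z v) = omega0 u v).

Definition gromov_width (R : realType) (n : nat) (W : normedModType R)
    (M : set W) (omega : W -> W -> W -> R) : \bar R :=
  ereal_sup [set a%:E | a in [set a : R | 0 < a /\
    exists f, symplectic_embedding (@symplectic_ball R n a) M omega f]].

Definition ellipsoid_eq (R : realType) (m : nat) (s q : 'rV[R]_m) : R :=
  \sum_(i < m) q 0 i ^+ 2 / s 0 i ^+ 2.

Definition ellipsoid (R : realType) (m : nat) (s : 'rV[R]_m) :
    set 'rV[R]_m :=
  [set q | ellipsoid_eq s q = 1].

Definition tangent_ellipsoid (R : realType) (m : nat) (s q : 'rV[R]_m) :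
    set 'rV[R]_m :=
  [set v | 'd (ellipsoid_eq s) q v = 0].

(* The cotangent bundle of the ellipsoid E, as a submanifold of
   T^* R^m = R^m x R^m: a covector at q is the functional dot p on T_q E, for
   a unique p in T_q E, and its dual norm is the Euclidean norm of p. *)
Definition cotangent_ellipsoid (R : realType) (m : nat) (s : 'rV[R]_m) :
    set (phase_space R m) :=
  [set z : phase_space R m | ellipsoid s z.1 /\ tangent_ellipsoid s z.1 z.2].

Definition disk_cotangent_ellipsoid (R : realType) (m : nat)
    (s : 'rV[R]_m) : set (phase_space R m) :=
  [set z : phase_space R m | cotangent_ellipsoid s z /\ euclidean_norm z.2 < 1].

(* The form p dq. The Liouville form of T^* E evaluates the covector dot p at
   the image u.1 of u under the differential of the projection (q, p) |-> q,
   so it is the restriction of this form to T^* E. *)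
Definition liouville (R : realType) (m : nat) (z u : phase_space R m) : R :=
  dot z.2 u.1.

Definition exterior_derivative (R : realType) (V : normedModType R)
    (lambda : V -> V -> R) (z u v : V) : R :=
  'D_u (fun w => lambda w v) z - 'D_v (fun w => lambda w u) z.

(* The sign makes it dq /\ dp, in agreement with omega0. *)
Definition canonical_form (R : realType) (m : nat)
    (z u v : phase_space R m) : R :=
  - exterior_derivative (@liouville R m) z u v.

Lemma derive_liouville (R : realType) (m : nat) (z u v : phase_space R m) :
  'D_u (fun w => liouville w v) z = dot u.2 v.1.
Proof.
rewrite /derive; apply/cvg_lim => //.
apply: (@cvg_trans _ ((fun=> dot u.2 v.1) @ (0 : R)^')); last exact: cvg_cst.
apply: near_eq_cvg; near=> h.
have h0 : h != 0 by near: h; exact: nbhs_dnbhs_neq.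
rewrite /liouville /dot -sumrB /GRing.scale /= mulr_sumr.
apply: eq_bigr => i _; rewrite !mxE -mulrBl addrK mulrA mulrA mulVf//.
by rewrite mul1r.
Unshelve. all: by end_near. Qed.

Lemma canonical_formE (R : realType) (m : nat) (z u v : phase_space R m) :
  canonical_form z u v = omega0 u v.
Proof.
rewrite /canonical_form /exterior_derivative !derive_liouville opprB.
by rewrite /dot /omega0 -sumrB; apply: eq_bigr => i _; rewrite mulrC.
Qed.

Definition semiaxes11cc (R : realType) (c : R) : 'rV[R]_4 :=
  \row_(i < 4) [:: 1; 1; c; c]`_i.

Lemma ellipsoid11ccE (R : realType) (c : R) :
  ellipsoid (semiaxes11cc c) =
  [set q : 'rV[R]_4 | q 0 0 ^+ 2 + q 0 1 ^+ 2 + q 0 2%:R ^+ 2 / c ^+ 2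
                      + q 0 3%:R ^+ 2 / c ^+ 2 = 1].
Proof.
rewrite /ellipsoid; apply/seteqP; split=> q /=;
  rewrite /ellipsoid_eq !big_ord_recr big_ord0 !mxE /= add0r expr1n !divr1;
  by move=> <-; do !congr (_ + _); do ?congr (_ / _); congr (q _ _ ^+ 2); apply/val_inj.
Qed.

Lemma tangent_ellipsoidE (R : realType) (m : nat) (s q : 'rV[R]_m) :
  tangent_ellipsoid s q =
  [set v | \sum_(i < m) q 0 i * v 0 i / s 0 i ^+ 2 = 0].
Proof.
have sumE : @ellipsoid_eq R m s =
    \sum_(i < m) ((s 0 i ^- 2) *: (fun w : 'rV[R]_m => w 0 i) ^+ 2).
  apply/funext => w; rewrite fct_sumE; apply: eq_bigr => i _.
  by rewrite /GRing.scale /= mulrC exprfctE.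
have dcoord (i : 'I_m) : differentiable (fun w : 'rV[R]_m => w 0 i) q.
  exact: differentiable_coord.
have dE : differentiable (ellipsoid_eq s) q.
  rewrite sumE; apply: differentiable_sum => i.
  exact/differentiableZ/differentiableX.
have derE v : 'd (ellipsoid_eq s) q v =
    2 * \sum_(i < m) q 0 i * v 0 i / s 0 i ^+ 2.
  have dq (i : 'I_m) : is_derive q v (fun w : 'rV[R]_m => w 0 i) (v 0 i).
    split; first exact: diff_derivable.
    rewrite /derive; apply/cvg_lim => //.
    apply: (@cvg_trans _ ((fun=> v 0 i) @ (0 : R)^')); last exact: cvg_cst.
    apply: near_eq_cvg; near=> h.
    have h0 : h != 0 by near: h; exact: nbhs_dnbhs_neq.
    by rewrite /= !mxE addrK /GRing.scale /= mulKf.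
  rewrite -deriveE// sumE derive_val mulr_sumr; apply: eq_bigr => i _.
  by rewrite /GRing.scale /= expr1; ring.
by apply/seteqP; split=> v /=; rewrite /tangent_ellipsoid /= derE;
  [move/eqP; rewrite mulf_eq0 pnatr_eq0 => /eqP | move=> ->; rewrite mulr0].
Unshelve. all: by end_near. Qed.

(* Main.v *)
(* Let m = min(1, c). The map x |-> (1 - |x|^2, sqrt(2 - |x|^2) x) sends the ball
   |x|^2 < 2 onto the round unit sphere minus a point, and the round metric pulls
   back to a metric that is at least (2 - |x|^2) |dx|^2. Hence its cotangent lift
   sends (x, y) to a covector of squared norm at most |y|^2 / (2 - |x|^2), which
   is < 1 on |x|^2 + |y|^2 < 2: the unit disk cotangent bundle of the sphere
   contains the ball B(a) for all a < 2 pi. The linear map from the sphere to an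
   ellipsoid whose semiaxes are all >= m stretches lengths by at least m, so its
   cotangent lift sends covectors of norm < m to covectors of norm < 1; rescaling
   by m gives B(a) for all a < 2 pi m. *)
Require Import Defs.
From HB Require Import structures.
From mathcomp Require Import all_boot all_order all_algebra.
From mathcomp Require Import all_classical all_reals all_analysis.
From mathcomp Require Import ring.

Set Implicit Arguments.
Unset Strict Implicit.
Unset Printing Implicit Defensive.

Import Order.TTheory GRing.Theory Num.Theory.
Import numFieldNormedType.Exports.

Local Open Scope classical_set_scope.
Local Open Scope ring_scope.

(** * Closure properties of maps of class $C^k$ on an open set *)

Section Smooth.
Context {R : realType} {V : normedModType R}.
Implicit Types (W : normedModType R) (U : set V) (k : nat).

(** The first-order expansion of [f] at [x] is also one for [g], because only values near [x] enter;
    uniqueness of the differential then identifies ['d g x] with ['d f x]. *)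
Lemma near_eq_differentiable W (f g : V -> W) (x : V) :
  (\near x, f x = g x) -> differentiable f x -> differentiable g x.
Proof.
move=> fg df; have [cf ef] := (diff_locallyP x f).1 df.
have fgx : f x = g x := nbhs_singleton fg.
have eg : g \o shift x = cst (g x) + 'd f x +o_ (0 : V) id.
  apply/eqaddoP => e e0; move/eqaddoP : ef => /(_ _ e0).
  apply: filter_app.
  have : \forall h \near (0 : V), f (h + x) = g (h + x).
    move: fg; rewrite (nbhs0P (fun y => f y = g y)) /=.
    by apply: filterS => h; rewrite addrC.
  by apply: filter_app; near=> h => /= fgh; rewrite !fctE /= -fgx -fgh.
apply/diff_locallyP; have dg : 'd g x = 'd f x :> (V -> W) by exact: diff_unique.
by rewrite dg.
Unshelve. all: by end_near. Qed.

(** On an open set, agreement holds near every point, so it passes to all directional derivatives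
    and the induction on [k] goes through. The $C^k$ proofs below use this to replace a derivative
    by an explicit formula valid only on [U]. *)
Lemma Ck_on_ext W k U (f g : V -> W) : open U ->
  (forall x, U x -> f x = g x) -> Ck_on k U f -> Ck_on k U g.
Proof.
move=> Uo; elim: k f g => [|k IH] f g fg /=.
  move=> cf x Ux.
  have nfg : \forall y \near x, f y = g y.
    by apply: filterS (open_nbhs_nbhs (conj Uo Ux)) => y; exact: fg.
  change (g @ x --> g x); rewrite -(fg _ Ux); apply: cvg_trans (cf x Ux).
  exact: near_eq_cvg.
have nfg x : U x -> \forall y \near x, f y = g y.
  by move=> Ux; apply: filterS (open_nbhs_nbhs (conj Uo Ux)) => y; exact: fg.
move=> [df Df]; split=> [x Ux|v].
  by apply: near_eq_differentiable (df x Ux); exact: nfg.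
by apply: IH (Df v) => x Ux; apply: near_eq_derive; exact: nfg.
Qed.

Lemma Ck_on_pred W k U (f : V -> W) : Ck_on k.+1 U f -> Ck_on k U f.
Proof.
elim: k f => [f [df _] x Ux|k IH f [df Df]].
  exact/differentiable_continuous/df.
by split=> // v; apply: IH; exact: Df.
Qed.

Lemma Ck_on_cst W k U (a : W) : Ck_on k U (fun=> a).
Proof.
elim: k a => [|k IH] a; first by move=> x _; exact: cvg_cst.
split=> [x _|v]; first exact: differentiable_cst.
rewrite (_ : 'D_v _ = fun=> 0); first exact: IH.
by apply/funext => x; rewrite derive_cst.
Qed.

Lemma Ck_onD W k U (f g : V -> W) : open U ->
  Ck_on k U f -> Ck_on k U g -> Ck_on k U (fun x => f x + g x).
Proof.
move=> Uo; elim: k f g => [|k IH] f g.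
  by move=> cf cg x Ux; apply: cvgD; [exact: cf|exact: cg].
move=> [df Df] [dg Dg]; split=> [x Ux|v].
  exact: differentiableD (df x Ux) (dg x Ux).
apply: (Ck_on_ext Uo _ (IH _ _ (Df v) (Dg v))) => x Ux.
by rewrite deriveD //; apply: diff_derivable; [exact: df|exact: dg].
Qed.

(** The Leibniz rule keeps undifferentiated factors, so the induction also needs [f] and [g]
    themselves one order lower, which [Ck_on_pred] supplies. *)
Lemma Ck_onM k U (f g : V -> R) : open U ->
  Ck_on k U f -> Ck_on k U g -> Ck_on k U (fun x => f x * g x).
Proof.
move=> Uo; elim: k f g => [|k IH] f g.
  by move=> cf cg x Ux; apply: cvgM; [exact: cf|exact: cg].
move=> Cf Cg; have [df Df] := Cf; have [dg Dg] := Cg; split=> [x Ux|v].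
  exact: differentiableM (df x Ux) (dg x Ux).
apply: (Ck_on_ext Uo _ (Ck_onD Uo (IH _ _ (Ck_on_pred Cf) (Dg v))
  (IH _ _ (Ck_on_pred Cg) (Df v)))) => x Ux.
by rewrite deriveM //; apply: diff_derivable; [exact: df|exact: dg].
Qed.

(** The derivative $-f'/f^2$ is a product of $f'$ and two copies of $1/f$, and $1/f$ is already of
    class $C^k$ by induction. *)
Lemma Ck_onV k U (f : V -> R) : open U -> (forall x, U x -> f x != 0) ->
  Ck_on k U f -> Ck_on k U (fun x => (f x)^-1).
Proof.
move=> Uo f0; elim: k => [|k IH] Cf.
  by move=> x Ux; apply: cvgV; [exact: f0|exact: Cf].
have [df Df] := Cf; split=> [x Ux|v].
  exact: differentiableV (df x Ux) (f0 x Ux).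
have CV := IH (Ck_on_pred Cf).
have C := Ck_onM Uo (Ck_on_cst k U (-1 : R)) (Ck_onM Uo (Ck_onM Uo CV CV) (Df v)).
apply: (Ck_on_ext Uo _ C) => x Ux.
rewrite deriveV ?f0 //; last exact/diff_derivable/df.
by rewrite /GRing.scale /= -expr2 exprVn; ring.
Qed.

Lemma differentiable_sqrt (f : V -> R) x : 0 < f x ->
  differentiable f x -> differentiable (fun y => Num.sqrt (f y)) x.
Proof.
move=> f0 df; apply: (differentiable_comp df).
by apply/derivable1_diffP; case: (is_derive1_sqrt f0).
Qed.

Lemma derive_comp_sqrt (f : V -> R) x v : 0 < f x -> differentiable f x ->
  'D_v (fun y => Num.sqrt (f y)) x = 'D_v f x / (2 * Num.sqrt (f x)).
Proof.
move=> f0 df.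
have ds : differentiable (@Num.sqrt R) (f x).
  by apply/derivable1_diffP; case: (is_derive1_sqrt f0).
rewrite deriveE; last exact: differentiable_sqrt.
rewrite (diff_comp df ds) /= diff1E // derive1E derive_sqrt // deriveE //.
Qed.

(** The derivative is $f'/(2\sqrt f)$, whose denominator is $C^k$ by induction and nonzero by
    positivity. *)
Lemma Ck_on_sqrt k U (f : V -> R) : open U -> (forall x, U x -> 0 < f x) ->
  Ck_on k U f -> Ck_on k U (fun x => Num.sqrt (f x)).
Proof.
move=> Uo f0; elim: k => [|k IH] Cf.
  move=> x Ux; apply: continuous_comp; first exact: Cf.
  exact: sqrt_continuous.
have [df Df] := Cf; split=> [x Ux|v].
  exact: differentiable_sqrt (f0 x Ux) (df x Ux).
have Cs := Ck_onM Uo (Ck_on_cst k U (2 : R)) (IH (Ck_on_pred Cf)).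
have C := Ck_onM Uo (Df v) (Ck_onV Uo _ Cs).
apply: (Ck_on_ext Uo _ (C _)) => x Ux.
  by rewrite derive_comp_sqrt ?f0 //; exact: df.
by rewrite mulf_neq0 // gt_eqF // sqrtr_gt0 f0.
Qed.

Lemma derive_scalel W (f : V -> R) (w : W) x v : differentiable f x ->
  'D_v (fun z => f z *: w) x = 'D_v f x *: w.
Proof.
by move=> df; rewrite !deriveE ?diffZl //; exact: differentiableZl.
Qed.

Lemma Ck_onZl W k U (f : V -> R) (w : W) : open U ->
  Ck_on k U f -> Ck_on k U (fun x => f x *: w).
Proof.
move=> Uo; elim: k f => [|k IH] f.
  by move=> cf x Ux; apply: cvgZr_tmp; exact: cf.
move=> [df Df]; split=> [x Ux|v]; first exact/differentiableZl/df.
apply: (Ck_on_ext Uo _ (IH _ (Df v))) => x Ux.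
by rewrite derive_scalel //; exact: df.
Qed.

Lemma Ck_on_linear W k U (f : {linear V -> W}) : continuous f -> Ck_on k U f.
Proof.
move=> cf; case: k => [|k]; first by move=> x _; exact: cf.
split=> [x _|v]; first exact: linear_differentiable.
rewrite (_ : 'D_v _ = fun=> f v); first exact: Ck_on_cst.
apply/funext => x; rewrite deriveE; last exact: linear_differentiable.
by rewrite diff_lin.
Qed.

Lemma Ck_on_sum W k U n (F : 'I_n -> V -> W) : open U ->
  (forall i, Ck_on k U (F i)) -> Ck_on k U (fun x => \sum_(i < n) F i x).
Proof.
move=> Uo CF; elim: n F CF => [|n IH] F CF.
  by apply: (Ck_on_ext Uo _ (Ck_on_cst k U 0)) => x _; rewrite big_ord0.
have C := Ck_onD Uo (CF ord0) (IH (fun i => F (lift ord0 i)) (fun i => CF _)).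
apply: (Ck_on_ext Uo _ C).
by move=> x _; rewrite big_ord_recl.
Qed.

End Smooth.

(** * Euclidean products, nondegeneracy of the standard form, and the splitting
    $\mathbb{R}^{n+1}=\mathbb{R}\times\mathbb{R}^n$ *)

Section Coordinates.
Context {R : realType} {n : nat}.
Implicit Types (u v w : 'rV[R]_n) (a : R).

Lemma dotDl u v w : dot (u + v) w = dot u w + dot v w.
Proof. by rewrite /dot -big_split; apply: eq_bigr => i _; rewrite mxE mulrDl. Qed.

Lemma dotZl a u w : dot (a *: u) w = a * dot u w.
Proof. by rewrite /dot mulr_sumr; apply: eq_bigr => i _; rewrite mxE mulrA. Qed.

Lemma dotC u w : dot u w = dot w u.
Proof. by apply: eq_bigr => i _; rewrite mulrC. Qed.

Lemma dotDr u v w : dot w (u + v) = dot w u + dot w v.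
Proof. by rewrite dotC dotDl !(dotC w). Qed.

Lemma dotZr a u w : dot w (a *: u) = a * dot w u.
Proof. by rewrite dotC dotZl dotC. Qed.

Lemma dot_ge0 u : 0 <= dot u u.
Proof. by apply: sumr_ge0 => i _; rewrite -expr2 sqr_ge0. Qed.

Lemma dot_delta u i : dot u (delta_mx 0 i) = u 0 i.
Proof.
rewrite /dot (bigD1 i) //= big1 => [|j ji]; rewrite mxE ?eqxx ?mulr1 ?addr0 //.
by rewrite (negbTE ji) mulr0.
Qed.

Lemma omega0E (u v : phase_space R n) :
  omega0 u v = dot u.1 v.2 - dot u.2 v.1.
Proof. by rewrite /dot -sumrB. Qed.

(** Pairing with $(0,e_i)$ and $(e_i,0)$ reads off every coordinate up to sign. This later yields
    injectivity of the differential of the chart. *)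
Lemma omega0_nondegenerate (u v : phase_space R n) :
  (forall w : phase_space R n, omega0 u w = omega0 v w) -> u = v.
Proof.
move=> uv; rewrite [u]surjective_pairing [v]surjective_pairing.
have dot0 (w : 'rV[R]_n) : dot w 0 = 0.
  by rewrite /dot big1 // => i _; rewrite mxE mulr0.
congr (_, _); apply/rowP => i.
  have := uv (0, delta_mx 0 i).
  by rewrite !omega0E /= !dot0 !subr0 !dot_delta.
have := uv (delta_mx 0 i, 0).
by rewrite !omega0E /= !dot0 !sub0r !dot_delta => /oppr_inj.
Qed.

Definition row_cons a u : 'rV[R]_n.+1 := \row_i oapp (u 0) a (unlift ord0 i).

Lemma row_cons0 a u : row_cons a u 0 ord0 = a.
Proof. by rewrite mxE unlift_none. Qed.

Lemma row_consS a u i : row_cons a u 0 (lift ord0 i) = u 0 i.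
Proof. by rewrite mxE liftK. Qed.

Lemma dot_row_cons a u b v : dot (row_cons a u) (row_cons b v) = a * b + dot u v.
Proof.
rewrite /dot big_ord_recl !row_cons0; congr (_ + _).
by apply: eq_bigr => i _; rewrite !row_consS.
Qed.

End Coordinates.

(** * Derivative rules in pointwise form, composable into closed formulas *)

Section Calculus.
Context {R : realType} {V : normedModType R}.
Implicit Types (f g : V -> R) (x v : V).

Lemma differentiable_is_derive f x v d :
  differentiable f x -> 'D_v f x = d -> is_derive x v f d.
Proof. by move=> df <-; exact/derivableP/diff_derivable. Qed.

Lemma is_derive_add f g x v a b : is_derive x v f a -> is_derive x v g b ->
  is_derive x v (fun z => f z + g z) (a + b).
Proof. by move=> fa gb; exact: is_deriveD. Qed.

Lemma is_derive_mul f g x v a b : is_derive x v f a -> is_derive x v g b ->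
  is_derive x v (fun z => f z * g z) (f x * b + g x * a).
Proof. by move=> fa gb; exact: is_deriveM. Qed.

Lemma is_derive_opp f x v a : is_derive x v f a ->
  is_derive x v (fun z => - f z) (- a).
Proof. by move=> fa; exact: is_deriveN. Qed.

Lemma is_derive_inv f x v a : f x != 0 -> is_derive x v f a ->
  is_derive x v (fun z => (f z)^-1) (- (f x) ^- 2 * a).
Proof.
by move=> f0 [fd <-]; apply: DeriveDef; [exact: derivableV|exact: deriveV].
Qed.

Lemma is_derive_bigsum (W : normedModType R) k (F : 'I_k -> V -> W)
    (d : 'I_k -> W) x v :
  (forall i, is_derive x v (F i) (d i)) ->
  is_derive x v (fun z => \sum_(i < k) F i z) (\sum_(i < k) d i).
Proof.
elim: k F d => [|k IH] F d Fd.
  rewrite big_ord0 (_ : (fun z => _) = fun=> 0); first exact: is_derive_cst.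
  by apply/funext => z; rewrite big_ord0.
rewrite big_ord_recl (_ : (fun z => _) =
  (fun z => F ord0 z) + (fun z => \sum_(i < k) F (lift ord0 i) z)).
  exact/is_deriveD/IH.
by apply/funext => z; rewrite big_ord_recl.
Qed.

End Calculus.

(** * Smoothness and derivatives of coordinates and dot products on phase space *)

Section PhaseSpace.
Context {R : realType} {n : nat}.
Notation V := (phase_space R n).
Implicit Types (z u v : V) (U : set V).

Let fst_coord (i : 'I_n) (z : V) : R := z.1 0 i.
Let snd_coord (i : 'I_n) (z : V) : R := z.2 0 i.

Let fst_coord_linear i : linear (fst_coord i).
Proof. by move=> a u v; rewrite /fst_coord /= !mxE. Qed.

Let snd_coord_linear i : linear (snd_coord i).
Proof. by move=> a u v; rewrite /snd_coord /= !mxE. Qed.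

HB.instance Definition _ i :=
  GRing.isLinear.Build R V R _ (fst_coord i) (fst_coord_linear i).
HB.instance Definition _ i :=
  GRing.isLinear.Build R V R _ (snd_coord i) (snd_coord_linear i).

Let fst_coord_continuous i : continuous (fst_coord i).
Proof.
move=> z; apply: (@continuous_comp _ _ _ fst (fun M : 'rV[R]_n => M 0 i)).
  exact: cvg_fst.
exact: coord_continuous.
Qed.

Let snd_coord_continuous i : continuous (snd_coord i).
Proof.
move=> z; apply: (@continuous_comp _ _ _ snd (fun M : 'rV[R]_n => M 0 i)).
  exact: cvg_snd.
exact: coord_continuous.
Qed.

Lemma Ck_on_fst_coord k U i : Ck_on k U (fun z : V => z.1 0 i).
Proof.
exact: (Ck_on_linear (f := fst_coord i) k U (@fst_coord_continuous i)).
Qed.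

Lemma Ck_on_snd_coord k U i : Ck_on k U (fun z : V => z.2 0 i).
Proof.
exact: (Ck_on_linear (f := snd_coord i) k U (@snd_coord_continuous i)).
Qed.

Lemma Ck_on_dot11 k U : open U -> Ck_on k U (fun z => dot z.1 z.1).
Proof.
move=> Uo; apply: (Ck_on_sum (F := fun i z => z.1 0 i * z.1 0 i) Uo) => i.
by apply: (Ck_onM Uo); exact: Ck_on_fst_coord.
Qed.

Lemma Ck_on_dot12 k U : open U -> Ck_on k U (fun z => dot z.1 z.2).
Proof.
move=> Uo; apply: (Ck_on_sum (F := fun i z => z.1 0 i * z.2 0 i) Uo) => i.
by apply: (Ck_onM Uo); [exact: Ck_on_fst_coord|exact: Ck_on_snd_coord].
Qed.

Lemma is_derive_fst_coord i z v : is_derive z v (fun z : V => z.1 0 i) (v.1 0 i).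
Proof.
have df : differentiable (fst_coord i) z.
  exact: (linear_differentiable (f := fst_coord i) z (@fst_coord_continuous i)).
apply: (differentiable_is_derive df); rewrite deriveE //.
by rewrite (diff_lin (f := fst_coord i) z (@fst_coord_continuous i)).
Qed.

Lemma is_derive_snd_coord i z v : is_derive z v (fun z : V => z.2 0 i) (v.2 0 i).
Proof.
have df : differentiable (snd_coord i) z.
  exact: (linear_differentiable (f := snd_coord i) z (@snd_coord_continuous i)).
apply: (differentiable_is_derive df); rewrite deriveE //.
by rewrite (diff_lin (f := snd_coord i) z (@snd_coord_continuous i)).
Qed.

Lemma is_derive_dot11 z v :
  is_derive z v (fun z : V => dot z.1 z.1) (2 * dot z.1 v.1).
Proof.
rewrite /dot mulr_sumr; apply: is_derive_bigsum => i.
apply: (is_derive_eq (is_derive_mul (is_derive_fst_coord i z v)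
  (is_derive_fst_coord i z v))).
by ring.
Qed.

Lemma is_derive_dot12 z v :
  is_derive z v (fun z : V => dot z.1 z.2) (dot z.2 v.1 + dot z.1 v.2).
Proof.
rewrite /dot -big_split; apply: is_derive_bigsum => i.
apply: (is_derive_eq (is_derive_mul (is_derive_fst_coord i z v)
  (is_derive_snd_coord i z v))).
by rewrite addrC.
Qed.

End PhaseSpace.

(** * Maps into phase space given by their coordinate functions *)

Section RowPair.
Context {R : realType} {V : normedModType R} {m : nat}.
Implicit Types (Q P : 'I_m -> V -> R) (z v : V).

(** Expansion in a fixed basis reduces smoothness and differentiation of a vector-valued map to its
    scalar coefficients. *)
Let row_pairE Q P z : (\row_i Q i z, \row_i P i z) =
  \sum_i Q i z *: (delta_mx 0 i, 0) + \sum_i P i z *: (0, delta_mx 0 i)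
  :> phase_space R m.
Proof.
rewrite [LHS]surjective_pairing [RHS]surjective_pairing /=.
congr (_, _).
  rewrite !raddf_sum [X in _ + X]big1 ?addr0 => [|i _]; last first.
    by rewrite /= scaler0.
  by rewrite [LHS]row_sum_delta; apply: eq_bigr => i _; rewrite mxE.
rewrite !raddf_sum [X in X + _]big1 ?add0r => [|i _]; last first.
  by rewrite /= scaler0.
by rewrite [LHS]row_sum_delta; apply: eq_bigr => i _; rewrite mxE.
Qed.

Let row_pair_funE Q P :
  (fun z => (\row_i Q i z, \row_i P i z) : phase_space R m) =
  fun z => \sum_i Q i z *: ((delta_mx 0 i, 0) : phase_space R m) +
           \sum_i P i z *: ((0, delta_mx 0 i) : phase_space R m).
Proof. by apply/funext => z; exact: row_pairE. Qed.

Lemma Ck_on_row_pair k (U : set V) Q P : open U ->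
  (forall i, Ck_on k U (Q i)) -> (forall i, Ck_on k U (P i)) ->
  Ck_on k U (fun z => (\row_i Q i z, \row_i P i z) : phase_space R m).
Proof.
move=> Uo CQ CP; rewrite row_pair_funE.
by apply: (Ck_onD Uo); apply: (Ck_on_sum Uo) => i; exact: Ck_onZl.
Qed.

Lemma diff_row_pair (U : set V) Q P z v : open U -> U z ->
  (forall i, Ck_on 1 U (Q i)) -> (forall i, Ck_on 1 U (P i)) ->
  'd (fun z => (\row_i Q i z, \row_i P i z) : phase_space R m) z v =
  (\row_i 'D_v (Q i) z, \row_i 'D_v (P i) z).
Proof.
move=> Uo Uz CQ CP; rewrite -deriveE; last first.
  by have [+ _] := Ck_on_row_pair Uo CQ CP; exact.
have dQ i : differentiable (Q i) z by have [+ _] := CQ i; exact.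
have dP i : differentiable (P i) z by have [+ _] := CP i; exact.
rewrite row_pair_funE (row_pairE (fun i => 'D_v (Q i)) (fun i => 'D_v (P i))).
have dZ (f : V -> R) (w : phase_space R m) : differentiable f z ->
    is_derive z v (fun y => f y *: w) ('D_v f z *: w).
  move=> df; rewrite -derive_scalel //.
  exact/derivableP/diff_derivable/differentiableZl.
apply: derive_val; apply: is_deriveD; apply: is_derive_bigsum => i;
  exact: dZ.
Qed.

End RowPair.

(** * The scaled chart of the unit sphere and its cotangent lift *)

Section SphereChart.
Context {R : realType} {n : nat} (m : R) (m_gt0 : 0 < m).
Notation V := (phase_space R n).
Implicit Types (z u v : V).

Definition chart_domain : set V := [set z | dot z.1 z.1 < 2 * m].

Definition chart_scale z : R := Num.sqrt (2 * m - dot z.1 z.1).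

(** With $x=\sqrt m\,x'$ this is $(1-|x'|^2,\sqrt{2-|x'|^2}\,x')$. Rescaling [x] and [y] both by
    $\sqrt m$ turns $p\cdot dq=y\cdot dx$ into $m$ times its normalized version. *)
Definition sphere_point z : 'rV[R]_n.+1 :=
  row_cons (1 - dot z.1 z.1 / m) ((chart_scale z / m) *: z.1).

(* The vector p orthogonal to q = sphere_point z such that p . dq = y . dx, where
   z = (x, y). *)
Definition sphere_covector z : 'rV[R]_n.+1 :=
  row_cons (- (dot z.1 z.2 * (2 * m - dot z.1 z.1) / (2 * m)))
    ((m / chart_scale z) *: z.2 +
     (- (dot z.1 z.2 * (3 * m - dot z.1 z.1) / (2 * m * chart_scale z))) *: z.1).

Lemma open_chart_domain : open chart_domain.
Proof.
apply: (open_comp (f := fun z : V => dot z.1 z.1) (D := [set r | r < 2 * m])).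
  by move=> z _; exact: (Ck_on_dot11 0 openT).
exact: open_lt.
Qed.

Lemma chart_scale_gt0 z : chart_domain z -> 0 < chart_scale z.
Proof. by move=> Uz; rewrite sqrtr_gt0 subr_gt0. Qed.

Lemma chart_scale_neq0 z : chart_domain z -> chart_scale z != 0.
Proof. by move=> Uz; rewrite gt_eqF // chart_scale_gt0. Qed.

Lemma dot11_chart_scale z : chart_domain z ->
  dot z.1 z.1 = 2 * m - chart_scale z ^+ 2.
Proof. by move=> Uz; rewrite sqr_sqrtr ?subKr // subr_ge0 ltW. Qed.

Let m_neq0 : m != 0. Proof. by rewrite gt_eqF. Qed.

Lemma dot_sphere_point z : chart_domain z ->
  dot (sphere_point z) (sphere_point z) = 1.
Proof.
move=> Uz; rewrite dot_row_cons !(dotZl, dotZr) dot11_chart_scale //.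
by field.
Qed.

(* The pulled back round metric dominates (2 - |x|^2) |dx|^2, with equality in
   the directions orthogonal to x (normalized to m = 1). *)
Lemma dot_sphere_covector_le z : chart_domain z ->
  dot (sphere_covector z) (sphere_covector z) <=
  m ^+ 2 * dot z.2 z.2 / (2 * m - dot z.1 z.1).
Proof.
move=> Uz; rewrite -subr_ge0.
have k0 := chart_scale_neq0 Uz.
(* The gap is computed exactly; it is nonnegative because $|x|^2<2m$. *)
rewrite (_ : _ - _ = dot z.1 z.2 ^+ 2 * (4 * m - dot z.1 z.1) /
                     (4 * chart_scale z ^+ 2)).
  apply: divr_ge0; last by rewrite mulr_ge0 ?sqr_ge0.
  rewrite mulr_ge0 ?sqr_ge0 // subr_ge0; apply/ltW/(lt_le_trans Uz).
  by rewrite ler_wpM2r ?(ltW m_gt0) // ler_nat.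
rewrite dot_row_cons !(dotDr, dotDl, dotZl, dotZr) (dotC z.2 z.1).
rewrite !dot11_chart_scale // !subKr.
by field; rewrite m_neq0 k0.
Qed.

(** The hypothesis gives $|y|^2<2m-|x|^2$, so the bound $m^2|y|^2/(2m-|x|^2)$ is below $m^2$. The
    factor $m^2$ is what the passage to the ellipsoid divides out. *)
Lemma sphere_covector_lt z : dot z.1 z.1 + dot z.2 z.2 < 2 * m ->
  dot (sphere_covector z) (sphere_covector z) < m ^+ 2.
Proof.
move=> z2m.
have Uz : chart_domain z by apply: le_lt_trans z2m; rewrite lerDl dot_ge0.
apply: le_lt_trans (dot_sphere_covector_le Uz) _.
rewrite ltr_pdivrMr ?subr_gt0 // ltr_pM2l ?exprn_gt0 //.
by rewrite ltrBrDl.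
Qed.

Let Uo := open_chart_domain.

Lemma Ck_on_scale_arg k : Ck_on k chart_domain (fun z => 2 * m - dot z.1 z.1).
Proof.
have C := Ck_onD Uo (Ck_on_cst k chart_domain (2 * m : R))
  (Ck_onM Uo (Ck_on_cst k chart_domain (-1 : R)) (Ck_on_dot11 k Uo)).
by apply: (Ck_on_ext Uo _ C) => z _; rewrite mulN1r.
Qed.

Lemma Ck_on_chart_scale k : Ck_on k chart_domain chart_scale.
Proof.
apply: (Ck_on_sqrt Uo) (Ck_on_scale_arg k) => z Uz.
by rewrite subr_gt0.
Qed.

Lemma Ck_on_sphere_point k i : Ck_on k chart_domain (fun z => sphere_point z 0 i).
Proof.
have Cc (r : R) := Ck_on_cst k chart_domain r.
case: (unliftP ord0 i) => [j|] ->.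
  have C := Ck_onM Uo (Ck_onM Uo (Ck_on_chart_scale k) (Cc m^-1))
    (Ck_on_fst_coord k chart_domain j).
  by apply: (Ck_on_ext Uo _ C) => z _; rewrite row_consS mxE.
have C := Ck_onD Uo (Cc 1) (Ck_onM Uo (Cc (- m^-1)) (Ck_on_dot11 k Uo)).
by apply: (Ck_on_ext Uo _ C) => z _; rewrite row_cons0 mulNr mulrC.
Qed.

Lemma Ck_on_sphere_covector k i :
  Ck_on k chart_domain (fun z => sphere_covector z 0 i).
Proof.
have Cc (r : R) := Ck_on_cst k chart_domain r.
have Cx := Ck_on_dot12 k Uo.
case: (unliftP ord0 i) => [j|] ->.
  have CV := Ck_onV Uo (fun z Uz => chart_scale_neq0 Uz) (Ck_on_chart_scale k).
  have C3 := Ck_onD Uo (Ck_on_scale_arg k) (Cc m).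
  have C := Ck_onD Uo
    (Ck_onM Uo (Ck_onM Uo (Cc m) CV) (Ck_on_snd_coord k chart_domain j))
    (Ck_onM Uo (Ck_onM Uo (Ck_onM Uo (Cc (- (2 * m)^-1)) CV) (Ck_onM Uo Cx C3))
      (Ck_on_fst_coord k chart_domain j)).
  apply: (Ck_on_ext Uo _ C) => z Uz; rewrite row_consS !mxE.
  by field; rewrite m_neq0 chart_scale_neq0.
have C := Ck_onM Uo (Ck_onM Uo (Cc (- (2 * m)^-1)) Cx) (Ck_on_scale_arg k).
by apply: (Ck_on_ext Uo _ C) => z _; rewrite row_cons0; field.
Qed.

Definition dchart_scale z v : R := - (dot z.1 v.1 / chart_scale z).

Lemma is_derive_scale_arg z v :
  is_derive z v (fun z => 2 * m - dot z.1 z.1) (- (2 * dot z.1 v.1)).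
Proof.
rewrite -[X in is_derive _ _ _ X]add0r.
apply: is_derive_add; apply: is_derive_opp; exact: is_derive_dot11.
Qed.

Lemma is_derive_chart_scale z v : chart_domain z ->
  is_derive z v chart_scale (dchart_scale z v).
Proof.
move=> Uz; pose f (w : V) := 2 * m - dot w.1 w.1.
have d : differentiable f z.
  by have [+ _] := Ck_on_scale_arg 1; exact.
have p0 : 0 < f z by rewrite subr_gt0.
apply: (differentiable_is_derive (differentiable_sqrt p0 d)).
rewrite (derive_comp_sqrt v p0 d).
rewrite (@derive_val _ _ _ _ _ _ _ (is_derive_scale_arg z v)).
rewrite /dchart_scale -/(chart_scale z).
by field; rewrite chart_scale_neq0.
Qed.

(** A closed form with coefficients rational in [chart_scale z], [m] and dot products, so that
    identities between differentials reduce to [field]. *)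
Definition dsphere_point z v : 'rV[R]_n.+1 :=
  row_cons (- (2 * dot z.1 v.1 / m))
    ((dchart_scale z v / m) *: z.1 + (chart_scale z / m) *: v.1).

Lemma is_derive_sphere_point z v i : chart_domain z ->
  is_derive z v (fun z => sphere_point z 0 i) (dsphere_point z v 0 i).
Proof.
move=> Uz.
have dc (r : R) : is_derive z v (fun=> r) 0 by exact: is_derive_cst.
case: (unliftP ord0 i) => [j|] ->.
  rewrite (_ : (fun z => _) =
    fun z => chart_scale z * m^-1 * z.1 0 j); last first.
    by apply/funext => w; rewrite row_consS mxE.
  rewrite row_consS !mxE.
  apply: (is_derive_eq (is_derive_mul (is_derive_mul (is_derive_chart_scale v Uz)
    (dc m^-1)) (is_derive_fst_coord j z v))).
  by ring.
rewrite (_ : (fun z => _) = fun z => 1 - dot z.1 z.1 * m^-1); last first.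
  by apply/funext => w; rewrite row_cons0.
rewrite row_cons0.
apply: (is_derive_eq (is_derive_add (dc 1) (is_derive_opp
  (is_derive_mul (is_derive_dot11 z v) (dc m^-1))))).
by ring.
Qed.

Definition dsphere_covector z v : 'rV[R]_n.+1 :=
  let k := chart_scale z in let dk := dchart_scale z v in
  let a := 3 * m - dot z.1 z.1 in
  let t := dot z.1 z.2 in let dt := dot z.2 v.1 + dot z.1 v.2 in
  row_cons (- ((dt * (2 * m - dot z.1 z.1) - 2 * t * dot z.1 v.1) / (2 * m)))
    ((- (m * dk / k ^+ 2)) *: z.2 + (m / k) *: v.2 +
     (- ((dt * a - 2 * t * dot z.1 v.1) / (2 * m * k)
         - t * a * dk / (2 * m * k ^+ 2))) *: z.1 +
     (- (t * a / (2 * m * k))) *: v.1).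

Lemma is_derive_sphere_covector z v i : chart_domain z ->
  is_derive z v (fun z => sphere_covector z 0 i) (dsphere_covector z v 0 i).
Proof.
move=> Uz; have k0 := chart_scale_neq0 Uz.
have ds := is_derive_scale_arg z v; have dt := is_derive_dot12 z v.
have dc (r : R) : is_derive z v (fun=> r) 0 by exact: is_derive_cst.
case: (unliftP ord0 i) => [j|] ->.
  (* Writing $3m-|x|^2$ as $(2m-|x|^2)+m$ lets the derivative [ds] serve here too. *)
  rewrite (_ : (fun z => _) = fun z => m * (chart_scale z)^-1 * z.2 0 j +
      (- (2 * m)^-1) * (dot z.1 z.2 * (2 * m - dot z.1 z.1 + m) *
       (chart_scale z)^-1) * z.1 0 j); last first.
    apply/funext => w; rewrite row_consS !mxE; congr (_ + _ * _).
    by rewrite invfM; ring.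
  rewrite row_consS !mxE.
  have dV := is_derive_inv k0 (is_derive_chart_scale v Uz).
  apply: (is_derive_eq (is_derive_add
    (is_derive_mul (is_derive_mul (dc m) dV) (is_derive_snd_coord j z v))
    (is_derive_mul (is_derive_mul (dc (- (2 * m)^-1)) (is_derive_mul
      (is_derive_mul dt (is_derive_add ds (dc m))) dV))
      (is_derive_fst_coord j z v)))).
  by field; rewrite m_neq0 k0.
rewrite (_ : (fun z => _) = fun z =>
    (- (2 * m)^-1) * (dot z.1 z.2 * (2 * m - dot z.1 z.1))); last first.
  by apply/funext => w; rewrite row_cons0; ring.
rewrite row_cons0.
apply: (is_derive_eq (is_derive_mul (dc (- (2 * m)^-1)) (is_derive_mul dt ds))).
by field.
Qed.

(** Infinitesimal form of $|q|^2=1$. It makes the normal correction of the ellipsoid chart invisible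
    to the symplectic form. *)
Lemma dot_sphere_point_dsphere_point z v : chart_domain z ->
  dot (sphere_point z) (dsphere_point z v) = 0.
Proof.
move=> Uz; rewrite dot_row_cons !(dotDr, dotZl, dotZr) dot11_chart_scale //.
rewrite /dchart_scale; by field; rewrite m_neq0 chart_scale_neq0.
Qed.

(** This is the exterior derivative of $p\cdot dq=y\cdot dx$, checked directly: after expansion only
    dot products and [chart_scale z] remain, and $|x|^2$ is eliminated. *)
Lemma sphere_chart_symplectic z u v : chart_domain z ->
  dot (dsphere_point z u) (dsphere_covector z v) -
  dot (dsphere_covector z u) (dsphere_point z v) = omega0 u v.
Proof.
move=> Uz; have k0 := chart_scale_neq0 Uz.
rewrite omega0E !dot_row_cons !(dotDr, dotDl, dotZl, dotZr) /dchart_scale.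
(* Symmetric products are put in one order, so that [field] sees a single atom for each. *)
rewrite (dotC u.1 z.1) (dotC u.1 z.2) (dotC u.2 z.1) (dotC z.2 z.1).
rewrite dot11_chart_scale //.
by field; rewrite m_neq0 k0.
Qed.

End SphereChart.

(** * Transport from the sphere to the ellipsoid *)

Section EllipsoidChart.
Context {R : realType} {n : nat} {m : R} {s : 'rV[R]_n.+1}.
Context (m_gt0 : 0 < m) (s_ge : forall i, m <= s 0 i).
Notation V := (phase_space R n).
Implicit Types (z u v : V).

Let s_gt0 i : 0 < s 0 i. Proof. exact: lt_le_trans (s_ge i). Qed.
Let s_neq0 i : s 0 i != 0. Proof. by rewrite gt_eqF. Qed.
Let m_neq0 : m != 0. Proof. by rewrite gt_eqF. Qed.
Let Uo : open (chart_domain m : set V). Proof. exact: open_chart_domain. Qed.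

Definition row_div (w : 'rV[R]_n.+1) : 'rV[R]_n.+1 := \row_i (w 0 i / s 0 i).

Let q z := sphere_point m z.
Let p z := sphere_covector m z.

(** The coefficient of the orthogonal projection of $(p_i/s_i)_i$ onto the normal line, so
    subtracting that component cannot lengthen the covector. *)
Definition normal_coef z : R :=
  dot (row_div (q z)) (row_div (p z)) / dot (row_div (q z)) (row_div (q z)).

(* The cotangent lift of q |-> (s_i q_i)_i, which maps the unit sphere to the
   ellipsoid: p is sent to (p_i / s_i)_i, made tangent by subtracting a multiple
   of the normal vector (q_i / s_i)_i. *)
Definition ellipsoid_chart z : phase_space R n.+1 :=
  (\row_i (s 0 i * q z 0 i),
   \row_i ((p z 0 i - normal_coef z * q z 0 i) / s 0 i)).

Lemma ellipsoid_chart2E z : (ellipsoid_chart z).2 =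
  row_div (p z) + (- normal_coef z) *: row_div (q z).
Proof. by apply/rowP => i; rewrite !mxE; ring. Qed.

(** A point of the unit sphere is nonzero, and division by the semiaxes keeps it so. Hence the
    denominator of [normal_coef] does not vanish. *)
Lemma dot_row_div_gt0 z : chart_domain m z ->
  0 < dot (row_div (q z)) (row_div (q z)).
Proof.
move=> Uz; rewrite lt0r dot_ge0 andbT; apply/eqP => d0.
have := dot_sphere_point m_gt0 Uz; rewrite -/(q z) => /eqP.
rewrite /dot big1 => [|i _]; first by rewrite eq_sym oner_eq0.
move/eqP: d0; rewrite /dot psumr_eq0 => [|j _]; last by rewrite -expr2 sqr_ge0.
move/allP => /(_ i (mem_index_enum i)) /=.
rewrite mxE mulf_eq0 orbb mulf_eq0 invr_eq0 (negbTE (s_neq0 i)) orbF.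
by move=> /eqP ->; rewrite mul0r.
Qed.

Lemma ellipsoid_chart_cotangent z : chart_domain m z ->
  cotangent_ellipsoid s (ellipsoid_chart z).
Proof.
move=> Uz; split.
  rewrite /ellipsoid /= -(dot_sphere_point m_gt0 Uz); apply: eq_bigr => i _.
  by rewrite mxE -/(q z); field.
rewrite tangent_ellipsoidE /=.
transitivity (dot (row_div (q z)) (ellipsoid_chart z).2).
  by apply: eq_bigr => i _; rewrite !mxE; field.
rewrite ellipsoid_chart2E dotDr dotZr /normal_coef mulNr divfK ?subrr //.
by rewrite gt_eqF // dot_row_div_gt0.
Qed.

(** By Pythagoras the squared norm is at most $\sum_i p_i^2/s_i^2$, hence at most $|p|^2/m^2$ since
    every $s_i\ge m$; and $|p|^2<m^2$. *)
Lemma ellipsoid_chart_norm z : dot z.1 z.1 + dot z.2 z.2 < 2 * m ->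
  euclidean_norm (ellipsoid_chart z).2 < 1.
Proof.
move=> z2m.
have Uz : chart_domain m z by apply: le_lt_trans z2m; rewrite lerDl dot_ge0.
have q0 := dot_row_div_gt0 Uz.
rewrite /euclidean_norm -[ltRHS]sqrtr1 ltr_sqrt //.
have -> : dot (ellipsoid_chart z).2 (ellipsoid_chart z).2 =
    dot (row_div (p z)) (row_div (p z)) -
    normal_coef z ^+ 2 * dot (row_div (q z)) (row_div (q z)).
  rewrite ellipsoid_chart2E !(dotDl, dotDr, dotZl, dotZr).
  rewrite (dotC (row_div (p z)) (row_div (q z))) /normal_coef.
  by field; rewrite gt_eqF.
apply: (@le_lt_trans _ _ (dot (p z) (p z) / m ^+ 2)).
  apply: (@le_trans _ _ (dot (row_div (p z)) (row_div (p z)))).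
    by rewrite gerBl mulr_ge0 ?sqr_ge0 ?ltW.
  rewrite /dot mulr_suml; apply: ler_sum => i _; rewrite mxE.
  rewrite mulrACA -!expr2 ler_wpM2l ?sqr_ge0 //.
  have sV : (s 0 i)^-1 <= m^-1 by rewrite lef_pV2 ?posrE.
  by rewrite -exprVn ler_pXn2r // nnegrE invr_ge0 ltW.
by rewrite ltr_pdivrMr ?exprn_gt0 // mul1r sphere_covector_lt.
Qed.

Let Ck_on_row_div (w w' : V -> 'rV[R]_n.+1) k :
  (forall i, Ck_on k (chart_domain m) (fun z => w z 0 i)) ->
  (forall i, Ck_on k (chart_domain m) (fun z => w' z 0 i)) ->
  Ck_on k (chart_domain m) (fun z => dot (row_div (w z)) (row_div (w' z))).
Proof.
move=> Cw Cw'; rewrite /dot.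
apply: (Ck_on_sum (F := fun i z => row_div (w z) 0 i * row_div (w' z) 0 i) Uo).
move=> i.
have C := Ck_onM Uo (Ck_onM Uo (Cw i) (Cw' i))
  (Ck_on_cst k _ (s 0 i ^- 2)).
apply: (Ck_on_ext Uo _ C) => z _; rewrite !mxE.
by field.
Qed.

Let Cq k i : Ck_on k (chart_domain m) (fun z => q z 0 i).
Proof. exact: Ck_on_sphere_point. Qed.

Let Cp k i : Ck_on k (chart_domain m) (fun z => p z 0 i).
Proof. exact: Ck_on_sphere_covector. Qed.

Lemma Ck_on_normal_coef k : Ck_on k (chart_domain m) normal_coef.
Proof.
apply: (Ck_onM Uo (Ck_on_row_div (Cq k) (Cp k))).
apply: (Ck_onV Uo) (Ck_on_row_div (Cq k) (Cq k)) => z Uz.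
by rewrite gt_eqF // dot_row_div_gt0.
Qed.

Let Ck_on_chart1 k i : Ck_on k (chart_domain m) (fun z => s 0 i * q z 0 i).
Proof. exact: (Ck_onM Uo (Ck_on_cst k _ (s 0 i : R)) (Cq k i)). Qed.

Let Ck_on_chart2 k i : Ck_on k (chart_domain m)
  (fun z => (p z 0 i - normal_coef z * q z 0 i) / s 0 i).
Proof.
have C := Ck_onM Uo (Ck_onD Uo (Cp k i) (Ck_onM Uo (Ck_on_cst k _ (-1 : R))
  (Ck_onM Uo (Ck_on_normal_coef k) (Cq k i)))) (Ck_on_cst k _ ((s 0 i)^-1 : R)).
by apply: (Ck_on_ext Uo _ C) => z _; rewrite mulN1r.
Qed.

Lemma ellipsoid_chart_smooth : smooth_on (chart_domain m) ellipsoid_chart.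
Proof. by move=> k; apply: Ck_on_row_pair. Qed.

(** The derivative of [normal_coef] is left unevaluated, since it cancels in the symplectic form. *)
Lemma diff_ellipsoid_chart z v : chart_domain m z ->
  'd ellipsoid_chart z v =
  (\row_i (s 0 i * dsphere_point m z v 0 i),
   \row_i ((dsphere_covector m z v 0 i -
            (normal_coef z * dsphere_point m z v 0 i +
             q z 0 i * 'D_v normal_coef z)) / s 0 i)).
Proof.
move=> Uz; rewrite (diff_row_pair v Uo Uz (Ck_on_chart1 1) (Ck_on_chart2 1)).
have dc (r : R) : is_derive z v (fun=> r) 0 by exact: is_derive_cst.
have dl : is_derive z v normal_coef ('D_v normal_coef z).
  apply/derivableP/diff_derivable.
  by have [+ _] := Ck_on_normal_coef 1; exact.
have dq i : is_derive z v (fun z => q z 0 i) (dsphere_point m z v 0 i).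
  exact: is_derive_sphere_point.
have dp i : is_derive z v (fun z => p z 0 i) (dsphere_covector m z v 0 i).
  exact: is_derive_sphere_covector.
congr (_, _); apply/rowP => i; rewrite [LHS]mxE [RHS]mxE.
  rewrite (@derive_val _ _ _ _ _ _ _ (is_derive_mul (dc (s 0 i)) (dq i))).
  by rewrite mulr0 addr0.
rewrite (@derive_val _ _ _ _ _ _ _ (is_derive_mul (is_derive_add (dp i)
  (is_derive_opp (is_derive_mul dl (dq i)))) (dc (s 0 i)^-1))).
by rewrite mulr0 add0r mulrC.
Qed.

Lemma ellipsoid_chart_symplectic z u v : chart_domain m z ->
  canonical_form (ellipsoid_chart z)
    ('d ellipsoid_chart z u) ('d ellipsoid_chart z v) = omega0 u v.
Proof.
move=> Uz; rewrite canonical_formE !diff_ellipsoid_chart //.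
rewrite -(sphere_chart_symplectic m_gt0 u v Uz).
have := dot_sphere_point_dsphere_point m_gt0 u Uz.
have := dot_sphere_point_dsphere_point m_gt0 v Uz.
rewrite -/(q z).
move: (dsphere_point m z u) (dsphere_point m z v) => dqu dqv.
move: (dsphere_covector m z u) (dsphere_covector m z v) => dpu dpv.
move: (q z) (normal_coef z) ('D_u _ z) ('D_v _ z) => qz l dlu dlv qdqv qdqu.
(* The factors $s_i$ and $1/s_i$ cancel, and the terms in [l] cancel by symmetry of $dq_u\cdot
   dq_v$. What remains of the correction is a multiple of $q\cdot dq$, which is zero. *)
transitivity (dot dqu dpv - dot dpu dqv - dlv * dot qz dqu + dlu * dot qz dqv).
  rewrite /omega0 /dot !mulr_sumr -!sumrB -big_split; apply: eq_bigr => i _ /=.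
  by rewrite !mxE; field.
by rewrite qdqu qdqv !mulr0 subr0 addr0.
Qed.

(** * The explicit inverse of the chart and its continuity *)

Let codomain : set (phase_space R n.+1) :=
  [set w : phase_space R n.+1 | 0 < m + m * (w.1 0 ord0 / s 0 ord0)].

(** On the image, $Q_0/s_0=q_0=1-|x|^2/m$, so the radicand is $2m-|x|^2$ and the first coordinate
    alone recovers [chart_scale]. *)
Let inv_scale (w : phase_space R n.+1) :=
  Num.sqrt (m + m * (w.1 0 ord0 / s 0 ord0)).

Let inv_point (w : phase_space R n.+1) (j : 'I_n) :=
  m * (w.1 0 (lift ord0 j) / s 0 (lift ord0 j)) / inv_scale w.

(** In $P\cdot dQ$ this sum comes from differentiating the factor $\sqrt{2m-|x|^2}$ of the chart. *)
Let inv_pairing (w : phase_space R n.+1) :=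
  \sum_(j < n) inv_point w j * (s 0 (lift ord0 j) * w.2 0 (lift ord0 j)).

(* P . dQ in the coordinates of the chart: it is y . dx for
   (Q, P) = ellipsoid_chart (x, y), so its components recover y. *)
Let inv_covector (w : phase_space R n.+1) (j : 'I_n) :=
  ((- 2) * inv_point w j * (s 0 ord0 * w.2 0 ord0) +
   inv_scale w * (s 0 (lift ord0 j) * w.2 0 (lift ord0 j)) -
   inv_pairing w * inv_point w j / inv_scale w) / m.

Definition ellipsoid_chart_inv (w : phase_space R n.+1) : V :=
  (\row_j inv_point w j, \row_j inv_covector w j).

Let inv_scaleE z : inv_scale (ellipsoid_chart z) = chart_scale m z.
Proof.
rewrite /inv_scale /chart_scale /= mxE; congr Num.sqrt.
by rewrite /q row_cons0; field; rewrite m_neq0 s_neq0.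
Qed.

Let inv_pointE z j : chart_domain m z ->
  inv_point (ellipsoid_chart z) j = z.1 0 j.
Proof.
move=> Uz; rewrite /inv_point inv_scaleE /= mxE /q row_consS mxE.
by field; rewrite m_neq0 s_neq0 chart_scale_neq0.
Qed.

(** The point [x] is read off from $Q$, then [y] from $P\cdot dQ=y\cdot dx$; the normal part of $P$
    drops out because $q\cdot dq=0$. *)
Lemma ellipsoid_chartK z : chart_domain m z ->
  ellipsoid_chart_inv (ellipsoid_chart z) = z.
Proof.
move=> Uz; have k0 := chart_scale_neq0 Uz.
have covectorE i : s 0 i * (ellipsoid_chart z).2 0 i =
    p z 0 i - normal_coef z * q z 0 i by rewrite mxE mulrC divfK.
have pairE : inv_pairing (ellipsoid_chart z) =
    dot z.1 ((m / chart_scale m z) *: z.2 +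
     (- (dot z.1 z.2 * (3 * m - dot z.1 z.1) / (2 * m * chart_scale m z)) -
      normal_coef z * (chart_scale m z / m)) *: z.1).
  apply: eq_bigr => j _; rewrite inv_pointE // covectorE.
  by rewrite /p /q !row_consS !mxE; ring.
rewrite [RHS]surjective_pairing; congr (_, _); apply/rowP => j; rewrite mxE.
  exact: inv_pointE.
rewrite /inv_covector inv_scaleE inv_pointE // pairE !covectorE.
rewrite /p /q !row_cons0 !row_consS !mxE dotDr !dotZr (dot11_chart_scale Uz).
by field; rewrite m_neq0 k0.
Qed.

Let codomainP z : chart_domain m z -> codomain (ellipsoid_chart z).
Proof.
move=> Uz; rewrite /codomain /= mxE /q row_cons0 mulrAC divff // mul1r.
have -> : m + m * (1 - dot z.1 z.1 / m) = 2 * m - dot z.1 z.1 by field.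
by rewrite subr_gt0.
Qed.

Let Ck_on_inv_scale_arg k (U : set (phase_space R n.+1)) : open U ->
  Ck_on k U (fun w => m + m * (w.1 0 ord0 / s 0 ord0)).
Proof.
move=> Uo'; exact: (Ck_onD Uo' (Ck_on_cst k U (m : R)) (Ck_onM Uo'
  (Ck_on_cst k U (m : R)) (Ck_onM Uo' (Ck_on_fst_coord k U ord0)
  (Ck_on_cst k U ((s 0 ord0)^-1 : R))))).
Qed.

Let open_codomain : open codomain.
Proof.
apply: (open_comp (f := fun w : phase_space R n.+1 =>
    m + m * (w.1 0 ord0 / s 0 ord0)) (D := [set r | 0 < r])).
  by move=> w _; exact: (Ck_on_inv_scale_arg 0 openT).
exact: open_gt.
Qed.

(** The inverse formulas make sense on the open set [codomain] of the ambient space, where the rules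
    for $C^0$ maps apply; continuity on the image follows by restriction. *)
Lemma ellipsoid_chart_inv_continuous z : chart_domain m z ->
  {for ellipsoid_chart z, continuous ellipsoid_chart_inv}.
Proof.
move=> Uz; move: (codomainP Uz); move: (ellipsoid_chart z).
have Uo' := open_codomain.
have Cc (r : R) := Ck_on_cst 0 codomain r.
have C1 i := Ck_on_fst_coord 0 codomain i.
have C2 i := Ck_on_snd_coord 0 codomain i.
have Cs : Ck_on 0 codomain inv_scale.
  by apply: (Ck_on_sqrt Uo') (Ck_on_inv_scale_arg 0 Uo') => w.
have CV : Ck_on 0 codomain (fun w => (inv_scale w)^-1).
  by apply: (Ck_onV Uo') Cs => w Uw; rewrite gt_eqF // sqrtr_gt0.
have Cx j : Ck_on 0 codomain (fun w => inv_point w j).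
  exact: (Ck_onM Uo' (Ck_onM Uo' (Cc m) (Ck_onM Uo' (C1 _) (Cc _))) CV).
have Csp i : Ck_on 0 codomain (fun w => s 0 i * w.2 0 i).
  exact: (Ck_onM Uo' (Cc (s 0 i)) (C2 i)).
have Cxp : Ck_on 0 codomain inv_pairing.
  apply: (Ck_on_sum (F := fun j w => inv_point w j *
    (s 0 (lift ord0 j) * w.2 0 (lift ord0 j))) Uo') => j.
  exact: (Ck_onM Uo' (Cx j) (Csp _)).
have Cy j : Ck_on 0 codomain (fun w => inv_covector w j).
  have C := Ck_onM Uo' (Ck_onD Uo' (Ck_onD Uo'
    (Ck_onM Uo' (Ck_onM Uo' (Cc (- 2)) (Cx j)) (Csp ord0))
    (Ck_onM Uo' Cs (Csp (lift ord0 j)))) (Ck_onM Uo' (Cc (-1))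
    (Ck_onM Uo' (Ck_onM Uo' Cxp (Cx j)) CV))) (Cc m^-1).
  by apply: (Ck_on_ext Uo' _ C) => w _; rewrite mulN1r.
exact: (Ck_on_row_pair Uo' Cx Cy).
Qed.

(** * Embedded balls and the bound on the Gromov width *)

Lemma ellipsoid_chart_symplectic_embedding a : a / pi < 2 * m ->
  symplectic_embedding (@symplectic_ball R n a) (disk_cotangent_ellipsoid s)
    (@canonical_form R n.+1) ellipsoid_chart.
Proof.
move=> am.
have ballE z : @symplectic_ball R n a z -> dot z.1 z.1 + dot z.2 z.2 < 2 * m.
  rewrite /symplectic_ball /= => za; apply: le_lt_trans am.
  by rewrite /dot -big_split.
have ballU : @symplectic_ball R n a `<=` chart_domain m.
  by move=> z /ballE; apply: le_lt_trans; rewrite lerDl dot_ge0.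
split; last by move=> z /ballU Uz u v; exact: ellipsoid_chart_symplectic.
split.
- by exists (chart_domain m); split => //; exact: ellipsoid_chart_smooth.
- move=> z Bz; split; first exact/ellipsoid_chart_cotangent/ballU.
  exact/ellipsoid_chart_norm/ballE.
(* A map preserving a nondegenerate form is an immersion. *)
- move=> z /ballU Uz u v duv; apply: omega0_nondegenerate => w.
  by rewrite -!(ellipsoid_chart_symplectic _ _ Uz) duv.
exists ellipsoid_chart_inv; split; last first.
  by move=> z /ballU; exact: ellipsoid_chartK.
apply: continuous_in_subspaceT => w; rewrite inE => -[z /ballU Uz <-].
exact: ellipsoid_chart_inv_continuous.
Qed.

Lemma gromov_width_disk_cotangent_ellipsoid :
  ((2 * pi * m)%:E <= @gromov_width R n _ (disk_cotangent_ellipsoid s)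
     (@canonical_form R n.+1))%E.
Proof.
have pi0 : 0 < pi :> R := pi_gt0 R.
have pm0 : 0 < 2 * pi * m by rewrite !mulr_gt0.
apply/lee_subgt0Pr => e e0.
(* The embedding needs $a<2\pi m$ strictly, so the bound is approached from below; the maximum with
   $\pi m$ keeps [a] positive when [e] is large. *)
pose a := Num.max (2 * pi * m - e) (pi * m).
apply: (@le_trans _ _ a%:E); first by rewrite -EFinB lee_fin le_max lexx.
apply: ereal_sup_ubound; exists a => //; split.
  by rewrite lt_max [X in _ || X]mulr_gt0 ?orbT.
exists ellipsoid_chart; apply: ellipsoid_chart_symplectic_embedding.
rewrite ltr_pdivrMr // mulrAC gt_max ltrBlDr ltrDl e0 /=.
by rewrite -mulrA ltr_pMl ?mulr_gt0 // ltr1n.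
Qed.

End EllipsoidChart.

Theorem theorem1p13 (R : realType) (c : R) (c_gt0 : 0 < c) :
  ((if c < 1 then 2 * pi * c else 2 * pi)%:E <=
   @gromov_width R 3 (phase_space R 4)
     (disk_cotangent_ellipsoid (semiaxes11cc c)) (@canonical_form R 4))%E.
Proof.
(* Any positive lower bound [m] of the semiaxes $1$ and $c$ will do; the two cases take the best
   one, $\min(1,c)$. *)
have widthP (m : R) : 0 < m -> m <= 1 -> m <= c ->
    ((2 * pi * m)%:E <= @gromov_width R 3 (phase_space R 4)
     (disk_cotangent_ellipsoid (semiaxes11cc c)) (@canonical_form R 4))%E.
  move=> m0 m1 mc; apply: gromov_width_disk_cotangent_ellipsoid => // i.
  by rewrite mxE; case: i => -[|[|[|[|]]]].
case: ifPn => [c1|]; first by apply: widthP => //; exact: ltW.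
by rewrite -leNgt => c1; rewrite -[2 * pi]mulr1; exact: widthP.
Qed.
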